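(* Let $n\ge 1$ and $0\le\ell\le n$ be integers and $Y_1,\dots,Y_\ell$ indeterminates. Then $$\det M_{n,\ell}(Y_1,\dots,Y_\ell)=\sum_{\pi\in C_{n,\ell}}Y_1^{\alpha_1(\pi)}Y_2^{\alpha_2(\pi)}\cdots Y_\ell^{\alpha_\ell(\pi)}.$$
   Context: Let $\imath=\sqrt{-1}$. $M_{n,\ell}(\mathbf{Y})$ is the $n\times n$ matrix with rows and columns indexed by $1,\dots,n$ whose $(k,j)$ entry is $\imath^{\,j-k}Y_{j-k+1}$ if $0\le j-k\le \ell-1$, is $\imath\, j$ if $k=j+1$, and is $0$ otherwise. $C_{n,\ell}$ is the set of permutations $\pi\in\mathfrak{S}_n$ all of whose cycles in the disjoint cycle decomposition have length at most $\ell$, and $\alpha_t(\pi)$ is the number of cycles of length $t$ in $\pi$. *)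

(* Defs.v *)
From mathcomp Require Import all_boot all_order all_algebra all_fingroup.
From mathcomp Require Import mpoly.

Set Implicit Arguments.
Unset Strict Implicit.
Unset Printing Implicit Defensive.

Import GRing.Theory Num.Theory.

Local Open Scope ring_scope.

(* Rows and columns are numbered from 0: the entry usually labelled           *)
(* (k.+1, j.+1) is the entry (k, j) here, and Y_(d.+1) is Y`_d. The guard     *)
(* [j - k < l] keeps the index within the tuple Y.                            *)
Definition cycle_mx (C : numClosedFieldType) (A : comAlgType C) (n l : nat)
    (Y : l.-tuple A) : 'M[A]_n :=
  \matrix_(k < n, j < n)
    if ((k <= j) && (j - k < l))%N then 'i ^+ (j - k)%N *: Y`_(j - k)%N
    else if k == j.+1 :> nat then ('i * j.+1%:R)%:A
    else 0.

(* [porbits pi] contains the fixed points of pi as singletons, so cycles of   *)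
(* length 1 are counted.                                                      *)
Definition bounded_cycle_perms (n l : nat) : {set 'S_n} :=
  [set pi : 'S_n | [forall c in porbits pi, #|c| <= l]%N].

Definition num_cycles (n t : nat) (pi : 'S_n) : nat :=
  #|[set c in porbits pi | #|c| == t]|.

Definition indeterminates (R : comNzRingType) (l : nat) : l.-tuple {mpoly R[l]} :=
  [tuple 'X_i | i < l].

(* Main.v *)
Require Import Defs.
From mathcomp Require Import all_boot all_order all_algebra all_fingroup.
From mathcomp Require Import mpoly ring.

(** Both sides satisfy the same recurrence once an offset [k] is added: on the
    permutation side, the cycle through a marked point [x] is weighted as if it
    had [k] extra elements; on the matrix side, the last column is shifted by
    [k].  Deleting [x] from its cycle either removes a fixed point or marks
    another point [a] with offset [k.+1]; expanding the determinant along its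
    last row, which has only two nonzero entries, produces the same two terms. *)

Local Open Scope ring_scope.

Import GRing.Theory Num.Theory.

Set Implicit Arguments.
Unset Strict Implicit.

(** The common recurrence: [n] points remain and [k] have already been absorbed into the marked
    cycle. At [k = 0] it is [n]! times the cycle index of the symmetric group. *)
Fixpoint cycle_rec (A : comNzRingType) (y : nat -> A) (n k : nat) : A :=
  if n is m.+1 then y k.+1 * cycle_rec y m 0 + cycle_rec y m k.+1 *+ m else 1.

(** * Cycle-weighted sums over permutations *)

Section CycleIndex.

Variables (T : finType) (A : comNzRingType) (y : nat -> A).
Implicit Types (p : {perm T}) (S : {set T}) (x a z : T).

Lemma permXS p i z : p ((p ^+ i)%g z) = (p ^+ i.+1)%g z.
Proof. by rewrite expgSr permM. Qed.

(** Products act left to right, so multiplying by [tperm x a] inserts the fixed point [x] into the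
    cycle of [a], just before [a]. *)
Lemma porbit_mul_tperm p x a : p x = x -> a != x ->
  porbit (p * tperm x a)%g x = x |: porbit p a.
Proof.
move=> px neq_ax; set q := (p * tperm x a)%g.
have qx : q x = a by rewrite permM px tpermL.
have x_notin i : (p ^+ i)%g a != x.
  by rewrite -(permX_fix i px) (inj_eq perm_inj).
apply/eqP; rewrite eqEsubset; apply/andP; split; apply/subsetP => z.
  case/porbitP => i ->; elim: i => [|i]; first by rewrite perm1 setU11.
  rewrite expgSr permM; move: ((q ^+ i)%g x) => w; rewrite 2!inE.
  case/orP => [/eqP -> | /porbitP[j ->]].
    by rewrite qx inE porbit_id orbT.
  rewrite permM permXS; case: tpermP => [/eqP|_|_ _].
  - by rewrite (negPf (x_notin _)).
  - by rewrite setU11.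
  - by rewrite inE mem_porbit orbT.
rewrite !inE => /orP[/eqP -> | /porbitP[i ->]]; first exact: porbit_id.
have ax : a \in porbit q x by apply/porbitP; exists 1; rewrite expg1 qx.
elim: i => [|i IH]; first by rewrite perm1.
(* Along the cycle of [a], [q] agrees with [p] except at the step that returns to [a]. *)
case: (eqVneq ((p ^+ i.+1)%g a) a) => [-> //|neq].
have <- : q ((p ^+ i)%g a) = (p ^+ i.+1)%g a.
  rewrite permM permXS tpermD // eq_sym //; exact: x_notin.
by case/porbitP: IH => j ->; rewrite permXS mem_porbit.
Qed.

Lemma porbit_mul_tperm_out p x a z : p x = x ->
  z != x -> z \notin porbit p a -> porbit (p * tperm x a)%g z = porbit p z.
Proof.
move=> px neq_zx z_notin; set q := (p * tperm x a)%g.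
have pi_x i : (p ^+ i)%g z != x by rewrite -(permX_fix i px) (inj_eq perm_inj).
have pi_a i : (p ^+ i)%g z != a.
  by apply: contra z_notin => /eqP <-; rewrite porbit_sym mem_porbit.
have qi i : (q ^+ i)%g z = (p ^+ i)%g z.
  elim: i => [|i IH]; first by rewrite !perm1.
  by rewrite expgSr permM IH permM permXS tpermD // eq_sym.
by apply/setP => w; apply/porbitP/porbitP => -[i ->]; exists i; rewrite qi.
Qed.

(** Indexing by the image set counts each cycle once. *)
Definition cycle_weight S p : A := \prod_(c in porbit p @: S) y #|c|.

Definition marked_weight S x k p : A :=
  y (k + #|porbit p x|)%N * \prod_(c in (porbit p @: S) :\ porbit p x) y #|c|.

Lemma marked_weight0 S x p : x \in S -> marked_weight S x 0 p = cycle_weight S p.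
Proof. by move=> xS; rewrite /cycle_weight (big_setD1 (porbit p x)) //= imset_f. Qed.

Lemma porbit_fix p x : p x = x -> porbit p x = [set x].
Proof.
move=> px; apply/setP => z; rewrite inE; apply/porbitP/eqP => [[i ->]|->].
  exact: permX_fix.
by exists 0; rewrite perm1.
Qed.

Lemma marked_weight_fix S x k p : x \in S -> p x = x ->
  marked_weight S x k p = y k.+1 * cycle_weight (S :\ x) p.
Proof.
move=> xS px; rewrite /marked_weight (porbit_fix px) cards1 addn1.
congr (_ * _); apply: eq_bigl => c; rewrite !inE.
apply/andP/imsetP => [[neq /imsetP[z zS def_c]]|[z /setD1P[neq zS] ->]].
  exists z => //; rewrite !inE zS andbT.
  by apply: contra neq => /eqP zx; rewrite def_c zx (porbit_fix px).
split; last exact: imset_f.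
by rewrite -(porbit_fix px) eq_porbit_mem (porbit_fix px) inE.
Qed.

(** Inserting [x] lengthens the cycle of [a] by one, which the offset [k.+1] records; all other
    cycles are unchanged. *)
Lemma marked_weight_mul_tperm S x a k p : x \in S -> a \in S :\ x -> p x = x ->
  marked_weight S x k (p * tperm x a)%g = marked_weight (S :\ x) a k.+1 p.
Proof.
move=> xS /setD1P[neq_ax aS] px; rewrite /marked_weight.
have xa : x \notin porbit p a.
  by rewrite porbit_sym (porbit_fix px) inE.
rewrite porbit_mul_tperm // cardsU1 xa add1n addnS addSn.
congr (_ * _); apply: eq_bigl => c; rewrite !inE -porbit_mul_tperm //.
apply/andP/andP => -[neq /imsetP[z zS def_c]].
  have : z \notin porbit (p * tperm x a)%g x.
    by rewrite -eq_porbit_mem -def_c.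
  rewrite porbit_mul_tperm // !inE negb_or => /andP[neq_zx z_notin].
  rewrite def_c porbit_mul_tperm_out // eq_porbit_mem z_notin.
  by split=> //; rewrite imset_f // !inE neq_zx.
case/setD1P: zS => neq_zx zS.
have z_notin : z \notin porbit p a by rewrite -eq_porbit_mem -def_c.
rewrite def_c -(porbit_mul_tperm_out px neq_zx z_notin) eq_porbit_mem.
by rewrite porbit_mul_tperm // !inE negb_or neq_zx z_notin; split=> //; exact: imset_f.
Qed.

Lemma perm_on_mul_tperm S x a p : x \in S -> a \in S ->
  perm_on S (p * tperm x a)%g && ((p * tperm x a)%g x == a)
  = perm_on (S :\ x) p.
Proof.
move=> xS aS.
have t_on : perm_on S (tperm x a).
  by apply/subsetP => z; rewrite inE; case: tpermP => [->|->|]; rewrite ?eqxx.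
have -> : ((p * tperm x a)%g x == a) = (p x == x).
  by rewrite permM -{2}(tpermL x a) (inj_eq perm_inj).
apply/andP/idP => [[q_on /eqP px]|p_on].
  have p_on : perm_on S p.
    by rewrite -[p](mulgK (tperm x a)) tpermV perm_onM.
  apply/subsetP => z; rewrite !inE => pz.
  rewrite (subsetP p_on) ?inE // andbT.
  by apply: contra pz => /eqP ->; rewrite px.
split; last by rewrite (out_perm p_on) // !inE eqxx.
apply: perm_onM => //; apply/subsetP => z /(subsetP p_on).
by rewrite inE => /andP[].
Qed.

(** Permutations are sorted by the image [a] of [x]; right multiplication by [tperm x a] identifies
    each class with the permutations of [S :\ x]. The first sum is the class [a = x]. *)
Lemma sum_perm_on S x (F : {perm T} -> A) : x \in S ->
  \sum_(p | perm_on S p) F p =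
  \sum_(p | perm_on (S :\ x) p) F p +
  \sum_(a in S :\ x) \sum_(p | perm_on (S :\ x) p) F (p * tperm x a)%g.
Proof.
move=> xS; rewrite (partition_big (fun p => p x) (mem S)) /=; last first.
  by move=> p /perm_closed ->.
have sub a : a \in S -> \sum_(p | perm_on S p && (p x == a)) F p =
    \sum_(p | perm_on (S :\ x) p) F (p * tperm x a)%g.
  move=> aS; rewrite (reindex_inj (mulIg (tperm x a))) /=.
  by apply: eq_bigl => p; rewrite perm_on_mul_tperm.
rewrite (big_setD1 x) //= sub // tperm1; congr (_ + _).
  by apply: eq_bigr => p _; rewrite mulg1.
by apply: eq_bigr => a /setD1P[_ /sub].
Qed.

(** Both claims go through one induction: removing a fixed point calls for the unmarked sum, moving
    the mark to [a] for the marked one. The unmarked sum is the marked one at offset 0, for any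
    point of [S]. *)
Lemma sum_weight_rec n S : #|S| = n ->
  \sum_(p | perm_on S p) cycle_weight S p = cycle_rec y n 0 /\
  forall x k, x \in S ->
    \sum_(p | perm_on S p) marked_weight S x k p = cycle_rec y n k.
Proof.
elim: n S => [|n IH] S cardS.
  have -> : S = set0 by apply/eqP; rewrite -cards_eq0 cardS.
  split=> [|x k]; last by rewrite inE.
  rewrite (big_pred1 1%g) /=; first by rewrite /cycle_weight imset0 big_set0.
  move=> p; apply/idP/eqP => [p_on|->]; last exact: perm_on1.
  by apply/permP => z; rewrite perm1 (out_perm p_on) ?inE.
have marked x k : x \in S ->
    \sum_(p | perm_on S p) marked_weight S x k p = cycle_rec y n.+1 k.
  move=> xS; have cardS' : #|S :\ x| = n.
    by apply/eqP; rewrite -eqSS -cardS (cardsD1 x S) xS.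
  have [IHw IHm] := IH _ cardS'.
  have fix_x p : perm_on (S :\ x) p -> p x = x.
    by move/out_perm => -> //; rewrite !inE eqxx.
  rewrite (sum_perm_on _ xS) /= -IHw mulr_sumr; congr (_ + _).
    by apply: eq_bigr => p /fix_x px; rewrite marked_weight_fix.
  (* The inner sum has the same value for each of the [n] choices of [a], hence the multiple in
     [cycle_rec]. *)
  rewrite -[X in _ *+ X]cardS' -sumr_const; apply: eq_bigr => a aS.
  rewrite -(IHm a) //; apply: eq_bigr => p /fix_x px.
  exact: marked_weight_mul_tperm.
split=> //; have /card_gt0P[x xS] : (0 < #|S|)%N by rewrite cardS.
by rewrite -(marked x) //; apply: eq_bigr => p _; rewrite marked_weight0.
Qed.

Lemma sum_cycle_weight :
  \sum_(p : {perm T}) \prod_(c in porbits p) y #|c| = cycle_rec y #|T| 0.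
Proof.
have [<- _] := sum_weight_rec (cardsT T).
apply: eq_big => [p|p _]; first by apply/esym/subsetP => z _; rewrite inE.
by apply: eq_bigl => c; apply/imsetP/imsetP => -[z _ ->]; exists z.
Qed.

End CycleIndex.

(** * Determinant of the shifted Hessenberg matrix *)

Section Hessenberg.

Variables (A : comNzRingType) (u : A) (y : nat -> A).

Definition shifted_mx n k : 'M[A]_n :=
  \matrix_(i < n, j < n)
    let s := if j.+1 == n then k else 0%N in
    if (i <= j)%N then u ^+ (j - i + s) * y (j - i + s).+1
    else if i == j.+1 :> nat then u * j.+1%:R else 0.

Lemma det_shifted_mx_rec m k :
  \det (shifted_mx m.+2 k) = u ^+ k * y k.+1 * \det (shifted_mx m.+1 0)
                             - u * m.+1%:R * \det (shifted_mx m.+1 k.+1).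
Proof.
rewrite (expand_det_row _ ord_max) !big_ord_recr /= big1 ?add0r; last first.
  move=> j _; rewrite !mxE /= leqNgt ltnS (ltnW (ltn_ord j)) /=.
  by rewrite eqSS gtn_eqF ?mul0r.
rewrite addrC; congr (_ + _).
  rewrite !mxE /= leqnn eqxx subnn add0n /cofactor addnn -signr_odd odd_double mul1r.
  (* Deleting the last column removes the shift, so this minor has offset 0. *)
  congr (_ * \det _); apply/matrixP => i j; rewrite !mxE !lift_max.
  by rewrite if_same eqSS ltn_eqF ?ltn_ord.
rewrite !mxE /= ltnn eqxx /cofactor addSn addnn -signr_odd /= odd_double mulN1r mulrN.
(* Without column [m], the old column [m.+1] becomes column [m] of the minor; the lost unit of
   [j - i] raises the offset to [k.+1]. *)
congr (- (_ * \det _)); apply/matrixP => i j; rewrite !mxE lift_max.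
have le_im : (i <= m)%N by rewrite -ltnS.
rewrite /lift /= /bump.
have [le_mj | lt_jm] := leqP m j.
  have -> : j = m :> nat by apply/eqP; rewrite eqn_leq le_mj -ltnS ltn_ord.
  by rewrite add1n eqxx (leqW le_im) le_im eqxx subSn // addSnnS.
by rewrite add0n !eqSS (ltn_eqF lt_jm) (ltn_eqF (leqW lt_jm)).
Qed.

(** Since [u ^+ 2 = -1], the factor [- u * u ^+ k.+1] equals [u ^+ k]: the cofactor sign disappears
    and the recurrence of [cycle_rec] remains. *)
Lemma det_shifted_mx n k : u ^+ 2 = -1 ->
  \det (shifted_mx n.+1 k) = u ^+ k * cycle_rec y n.+1 k.
Proof.
move=> u2; elim: n k => [|m IH] k.
  by rewrite det_mx11 mxE /= mulr1 mulr0n addr0.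
rewrite det_shifted_mx_rec !IH.
have -> : cycle_rec y m.+2 k =
  y k.+1 * cycle_rec y m.+1 0 + cycle_rec y m.+1 k.+1 *+ m.+1 by [].
rewrite -[_ *+ m.+1 in RHS]mulr_natr exprS.
move: (cycle_rec y m.+1) (m.+1%:R) => r c.
by ring: u2.
Qed.

End Hessenberg.

(** * Specialization to finitely many indeterminates *)

Lemma cycle_mx_shifted (C : numClosedFieldType) (A : comAlgType C) n l
    (Y : l.-tuple A) :
  cycle_mx n Y = shifted_mx ('i%:A) (fun t => Y`_t.-1) n 0.
Proof.
apply/matrixP => i j; rewrite !mxE /= if_same addn0.
have [le_ij | _] /= := leqP i j; last first.
  by rewrite -scalerAl mul1r -scalerA scaler_nat.
(* Past the end of [Y] the default value 0 of [nth] reproduces the guard in [cycle_mx]. *)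
have [lt_l | le_l] := ltnP (j - i) l.
  by rewrite exprZn expr1n -scalerAl mul1r.
rewrite [Y`_ _]nth_default ?size_tuple // mulr0; case: eqP => // eq_ij.
by rewrite eq_ij ltnn in le_ij.
Qed.

(** A cycle longer than [l] reads the default 0 and kills the product, so the sum over all of ['S_n]
    reduces to the bounded permutations. *)
Lemma prod_cycles_indeterminates (R : comNzRingType) n l (p : 'S_n) :
  \prod_(c in porbits p) (indeterminates R l)`_#|c|.-1 =
  if p \in bounded_cycle_perms n l then
    \prod_(t < l) ('X_t : {mpoly R[l]}) ^+ num_cycles t.+1 p
  else 0.
Proof.
rewrite inE; case: ifPn => [/forall_inP bounded|]; last first.
  rewrite negb_forall_in => /exists_inP[c cp]; rewrite -ltnNge => lt_l.
  rewrite (bigD1 c) //= nth_default ?mul0r // size_tuple.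
  by rewrite card_ord -ltnS (ltn_predK lt_l).
(* Each factor becomes a product over all [t] with a 0/1 exponent; exchanging the products then
   turns the exponents into cycle counts. *)
have cardE c : c \in porbits p -> (indeterminates R l)`_#|c|.-1 =
    \prod_(t < l) ('X_t : {mpoly R[l]}) ^+ (#|c| == t.+1).
  move=> cp; have c_gt0 : (0 < #|c|)%N.
    by case/imsetP: cp => x _ ->; apply/card_gt0P; exists x; exact: porbit_id.
  have lt_l : (#|c|.-1 < l)%N by rewrite prednK // bounded.
  rewrite (bigD1 (Ordinal lt_l)) //= prednK // eqxx expr1 big1 ?mulr1.
    have := tnth_mktuple (fun i => 'X_i : {mpoly R[l]}) (Ordinal lt_l).
    by rewrite (tnth_nth 0).
  move=> t neq; case: eqP => // eq_c; case/eqP: neq; apply: val_inj.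
  by rewrite /= eq_c.
rewrite (eq_bigr _ cardE) exchange_big /=; apply: eq_bigr => t _.
rewrite prodrXr; congr (_ ^+ _); rewrite /num_cycles -sum1dep_card.
by rewrite big_mkcondr /=; apply: eq_bigr => c _; case: eqP.
Qed.

Unset Implicit Arguments.
Set Strict Implicit.

Theorem theorem7p2 (C : numClosedFieldType) (n l : nat)
    (n_ge1 : (1 <= n)%N) (l_le_n : (l <= n)%N) :
  \det (cycle_mx n (indeterminates C l)) =
  \sum_(pi in bounded_cycle_perms n l)
    \prod_(t < l) ('X_t : {mpoly C[l]}) ^+ num_cycles t.+1 pi.
Proof.
rewrite big_mkcond /= cycle_mx_shifted; case: n n_ge1 {l_le_n} => // m _.
rewrite det_shifted_mx; last by rewrite exprZn expr1n sqrCi scaleN1r.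
rewrite expr0 mul1r -[in LHS](card_ord m.+1) -sum_cycle_weight.
by apply: eq_bigr => p _; rewrite prod_cycles_indeterminates.
Qed.
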